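(* Let $\mathrm{BM}$ be a finitely presented, strongly torsion generated, acyclic group that contains an isomorphic copy of every finitely presented group. The following assertions are equivalent: (i) the weak Bass conjecture holds for all groups; (ii) the weak Bass conjecture holds for the finitely presented acyclic group $\mathrm{BM}$; (iii) the weak Bass conjecture holds for the universal binate group on $\mathrm{BM}$; (iv) the weak Bass conjecture holds for the binate group $A(\mathrm{BM})$.
   Context: Acyclic and strongly torsion generated: a group $G$ is acyclic if $H_n(G;\mathbb{Z})=0$ for all $n\geq1$; it is strongly torsion generated if for each $n\geq 2$ there is an element of order $n$ in $G$ whose normal closure is $G$. A group $\mathrm{BM}$ with the stated properties is known to exist (Berrick-Miller). Weak Bass conjecture: for a group $G$ and a finitely generated projective $\mathbb{Z}G$-module $P$, represented by an idempotent matrix over $\mathbb{Z}G$ with matrix trace $M=\sum_{g\in G}m_g g\in\mathbb{Z}G$, set $r_P(s)=\sum_{g\in[s]}m_g$ for each conjugacy class $[s]$ of $G$ (this depends only on $P$ and $[s]$, and is zero for all but finitely many $[s]$). The weak Bass conjecture for $G$ asserts that for every finitely generated projective $\mathbb{Z}G$-module $P$ one has $\sum_{[s]\neq[e]}r_P(s)=0$; equivalently, $\mathrm{rank}_{\mathbb{Z}}(\mathbb{Z}\otimes_{\mathbb{Z}G}P)=r_P(e)$, where $e$ is the identity of $G$. Binate groups: with $[u,v]=uvu^{-1}v^{-1}$, a nontrivial group $G$ is binate if for every finitely generated subgroup $H$ of $G$ there exist a homomorphism $\varphi_H:H\rightarrow G$ and an element $u_H\in G$ such that $h=[u_H,\varphi_H(h)]$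 for all $h\in H$. Universal binate group on a group $H$: let $H_0=H$ and for $i\geq0$ let $H_{i+1}$ be the HNN extension $$H_{i+1}=\langle H_i\times H_i,\,u_i\mid (g,g)=u_i(1,g)u_i^{-1}\ \text{for each } g\in H_i\rangle,$$ with $H_i$ embedded in $H_{i+1}$ as $H_i\times 1$. The universal binate group on $H$ is the direct limit of the $H_i$; it is binate. The group $A(G)$: let $G$ be a group and $\{F_i\}_{i\in I}$ the set of all finitely generated abelian subgroups of $G$; let $C_i$ be the centralizer of $F_i$ in $G$. In $G\times G$ put $\Delta_{C_i}=\{(c,c)\mid c\in C_i\}$ and $\Delta'_{F_i}=\{(f^{-1},f)\mid f\in F_i\}$. Then $(1\times F_i)\cdot\Delta_{C_i}$ and $\Delta'_{F_i}\cdot(1\times C_i)$ are subgroups of $G\times G$, and $(k,fk)\mapsto(f^{-1},fk)$ ($f\in F_i$, $k\in C_i$) is an isomorphism from the first to the second. Let $A_1(G)$ be the generalized HNN extension of $G\times G$ with stable letters $t_i$ ($i\in I$) and relations $(k,fk)=t_i(f^{-1},fk)t_i^{-1}$ for all $f\in F_i$, $k\in C_i$, $i\in I$. The group $G$ is embedded in $A_1(G)$ by $g\mapsto(g,1)$. Inductively $A_n(G)=A_1(A_{n-1}(G))$ for $n\geq2$, and $A(G)=\bigcup_n A_n(G)$; it is a binate group. *)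

(* Defs.v *)
From HB Require Import structures.
From mathcomp Require Import all_boot all_order all_algebra.
From mathcomp Require Import generic_quotient finmap monalg.
From mathcomp Require Import boolp classical_sets fsbigop.

Set Implicit Arguments.
Unset Strict Implicit.
Unset Printing Implicit Defensive.

Import GRing.Theory.

(* Groups are of type [groupType].  The choice operator carried by that       *)
(* structure is no restriction, since [boolp] provides one for every type.    *)
(* The library's [x ^ y] and [[~ x, y]] are y^-1xy and x^-1y^-1xy; neither is *)
(* used here: conjugates are written out as in [conj_class].                  *)

Notation ghom G H := (UMagmaMorphism.type G H).

Section Subgroups.
Variable G : groupType.
Implicit Types (A F : set G) (g : G).
Local Open Scope group_scope.
Local Open Scope classical_set_scope.

Definition is_subgroup F : Prop :=
  F 1 /\ forall x y, F x -> F y -> F (x * y^-1).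

Definition is_normal_subgroup F : Prop :=
  is_subgroup F /\ forall x h, F x -> F (h * x * h^-1).

Definition generated A : set G := smallest is_subgroup A.

Definition normal_closure A : set G := smallest is_normal_subgroup A.

Definition fg_abelian_subgroup F : Prop :=
  (exists s : seq G, F = generated [set` s]) /\
  (forall x y, F x -> F y -> commute x y).

Definition centralizer F : set G := [set c | forall f, F f -> commute c f].

Definition conj_class g : set G := [set x | exists h, x = h * g * h^-1].

Definition has_order g (n : nat) : Prop :=
  [/\ (0 < n)%N, g ^+ n = 1 & forall m, (0 < m < n)%N -> g ^+ m <> 1].

Definition strongly_torsion_generated : Prop :=
  forall n, (2 <= n)%N ->
    exists g, has_order g n /\ normal_closure [set g] = [set: G].

End Subgroups.

(* The letter (x, false) is the generator x, and (x, true) is its inverse;    *)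
(* the word_cong-classes form the group < X | R >.                            *)
Definition word (X : Type) := seq (X * bool).

Section Presentation.
Variables (X : Type) (R : set (word X)).

Inductive word_cong : word X -> word X -> Prop :=
  | WCrefl u : word_cong u u
  | WCsym u v : word_cong u v -> word_cong v u
  | WCtrans u v w : word_cong u v -> word_cong v w -> word_cong u w
  | WCcat u u' v v' :
      word_cong u u' -> word_cong v v' -> word_cong (u ++ v) (u' ++ v')
  | WCcancel x b : word_cong [:: (x, b); (x, ~~ b)] [::]
  | WCrel r : R r -> word_cong r [::].

Definition word_equiv : rel {classic word X} := fun u v => `[< word_cong u v >].

Lemma word_equivP (u v : word X) : reflect (word_cong u v) (word_equiv u v).
Proof. exact: asboolP. Qed.

Lemma word_equiv_refl : reflexive word_equiv.
Proof. by move=> u; apply/word_equivP; apply: WCrefl. Qed.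

Lemma word_equiv_sym : symmetric word_equiv.
Proof. by move=> u v; apply/word_equivP/word_equivP; apply: WCsym. Qed.

Lemma word_equiv_trans : transitive word_equiv.
Proof.
move=> v u w /word_equivP uv /word_equivP vw; apply/word_equivP.
exact: WCtrans uv vw.
Qed.

Definition word_eqr :=
  EquivRel word_equiv word_equiv_refl word_equiv_sym word_equiv_trans.

Definition presented : Type := {eq_quot word_eqr}%qT.

HB.instance Definition _ := Choice.on presented.
HB.instance Definition _ := EqQuotient.on presented.

Definition word_class (w : word X) : presented :=
  \pi_presented%qT (w : {classic word X}).

Lemma word_class_eq (u v : word X) :
  word_class u = word_class v <-> word_cong u v.
Proof.
split=> [/eqP|uv]; first by rewrite eqmodE => /word_equivP.
by apply/eqP; rewrite eqmodE; apply/word_equivP.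
Qed.

Definition word_rep (a : presented) : word X := repr a.

Lemma word_repK : cancel word_rep word_class.
Proof. by move=> a; rewrite /word_class /word_rep reprK. Qed.

Definition word_inv (w : word X) : word X := rev [seq (l.1, ~~ l.2) | l <- w].

Lemma word_inv_mulg (w : word X) : word_cong (word_inv w ++ w) [::].
Proof.
elim: w => [|[x b] w IHw]; first exact: WCrefl.
rewrite /word_inv /= rev_cons cat_rcons.
have h : word_cong ((x, ~~ b) :: (x, b) :: w) w.
  have := @WCcat _ _ _ _ (WCcancel x (~~ b)) (WCrefl w).
  by rewrite /= negbK.
by apply: WCtrans IHw; apply: WCcat h; apply: WCrefl.
Qed.

Lemma word_invK : involutive word_inv.
Proof.
move=> w; rewrite /word_inv map_rev revK -map_comp -[RHS]map_id.
by apply: eq_map => -[x b] /=; rewrite negbK.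
Qed.

Lemma word_mulg_inv (w : word X) : word_cong (w ++ word_inv w) [::].
Proof. by have := word_inv_mulg (word_inv w); rewrite word_invK. Qed.

Lemma word_cong_inv (u v : word X) :
  word_cong u v -> word_cong (word_inv u) (word_inv v).
Proof.
move=> uv; rewrite -[word_inv u]cats0 -[word_inv v]cat0s.
apply: (@WCtrans _ (word_inv u ++ (v ++ word_inv v))).
  by apply: WCcat; [exact: WCrefl|exact: WCsym (word_mulg_inv v)].
rewrite catA; apply: WCcat (WCrefl _).
apply: WCtrans (word_inv_mulg u).
by apply: WCcat; [exact: WCrefl|exact: WCsym].
Qed.

Definition presented_one : presented := word_class [::].
Definition presented_mul (a b : presented) : presented :=
  word_class (word_rep a ++ word_rep b).
Definition presented_inv (a : presented) : presented :=
  word_class (word_inv (word_rep a)).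

Lemma word_rep_class (w : word X) : word_cong (word_rep (word_class w)) w.
Proof. by apply/word_class_eq; rewrite word_repK. Qed.

Lemma presented_mulE (u v : word X) :
  presented_mul (word_class u) (word_class v) = word_class (u ++ v).
Proof. by apply/word_class_eq; apply: WCcat; apply: word_rep_class. Qed.

Lemma presented_invE (u : word X) :
  presented_inv (word_class u) = word_class (word_inv u).
Proof. by apply/word_class_eq; apply: word_cong_inv; apply: word_rep_class. Qed.

Lemma presented_mulA : associative presented_mul.
Proof.
move=> a b c; rewrite -[a]word_repK -[b]word_repK -[c]word_repK.
by rewrite !presented_mulE catA.
Qed.

Lemma presented_mul1g : left_id presented_one presented_mul.
Proof. by move=> a; rewrite -[a]word_repK presented_mulE cat0s. Qed.

Lemma presented_mulg1 : right_id presented_one presented_mul.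
Proof. by move=> a; rewrite -[a]word_repK presented_mulE cats0. Qed.

Lemma presented_mulVg :
  left_inverse presented_one presented_inv presented_mul.
Proof.
move=> a; rewrite -[a]word_repK presented_invE presented_mulE.
by apply/word_class_eq; apply: word_inv_mulg.
Qed.

Lemma presented_mulgV :
  right_inverse presented_one presented_inv presented_mul.
Proof.
move=> a; rewrite -[a]word_repK presented_invE presented_mulE.
by apply/word_class_eq; apply: word_mulg_inv.
Qed.

HB.instance Definition _ := isGroup.Build presented
  presented_mulA presented_mul1g presented_mulg1 presented_mulVg presented_mulgV.

End Presentation.

Definition isomorphic (G H : groupType) : Prop :=
  exists f : ghom G H, bijective f.

Definition embeds (G H : groupType) : Prop :=
  exists f : ghom G H, injective f.

Definition finitely_presented (G : groupType) : Prop :=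
  exists (n : nat) (r : seq (word 'I_n)),
    isomorphic G (presented [set` r]%classic).

(* Generalized HNN extension of the base group G: one stable letter t_i for   *)
(* each i : I, and one relation a = t_i b t_i^-1 for each (a, b) in S i.      *)
(* The words of shape x y (xy)^-1 impose the multiplication table of G.       *)
Section HNN.
Variables (G : groupType) (I : Type) (S : I -> set (G * G)).
Local Open Scope group_scope.

Let base (g : G) : (G + I) * bool := (inl g, false).
Let baseV (g : G) : (G + I) * bool := (inl g, true).
Let stable (i : I) : (G + I) * bool := (inr i, false).
Let stableV (i : I) : (G + I) * bool := (inr i, true).

Inductive hnn_relator : word (G + I) -> Prop :=
  | HNNbase (x y : G) : hnn_relator [:: base x; base y; baseV (x * y)]
  | HNNstable (i : I) (a b : G) : S i (a, b) ->
      hnn_relator [:: base a; stable i; baseV b; stableV i].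

Definition hnn : groupType := presented hnn_relator.

Definition hnn_base (g : G) : hnn := word_class hnn_relator [:: base g].

Lemma hnn_baseM : {morph hnn_base : x y / x * y}.
Proof.
move=> x y; rewrite [RHS]presented_mulE; apply/word_class_eq => /=.
apply: WCsym; rewrite -[X in word_cong _ _ X]cat0s.
have h := @WCrel _ hnn_relator _ (HNNbase x y).
have := WCcat h (WCrefl hnn_relator [:: base (x * y)]).
apply: WCtrans; apply: WCsym => /=.
rewrite -[X in word_cong _ _ X]cats0.
apply: (@WCcat _ _ [:: base x; base y] [:: base x; base y]
   [:: baseV (x * y); base (x * y)] [::] (WCrefl _ _)).
exact: WCcancel.
Qed.

Lemma hnn_base1 : hnn_base 1 = 1.
Proof. by apply: (@mulgI _ (hnn_base 1)); rewrite -hnn_baseM !mulg1. Qed.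

HB.instance Definition _ :=
  isUMagmaMorphism.Build G hnn hnn_base (hnn_base1, hnn_baseM).

End HNN.

Section DirectLimit.
Variables (T : nat -> groupType) (f : forall n, ghom (T n) (T n.+1)).
Local Open Scope group_scope.

Definition lim_pre : Type := {classic {n & T n}}.

HB.instance Definition _ := Choice.on lim_pre.

Definition lim_step (u : {n & T n}) : {n & T n} :=
  Tagged (fun n => T n) (f _ (tagged u)).

(* Elements of the terms T m and T n are identified when their images in some *)
(* later term agree.                                                          *)
Definition lim_equiv : rel lim_pre :=
  fun u v => `[< exists p q, iter p lim_step u = iter q lim_step v >].

Lemma lim_equivP (u v : {n & T n}) :
  reflect (exists p q, iter p lim_step u = iter q lim_step v) (lim_equiv u v).
Proof. exact: asboolP. Qed.

Lemma lim_equiv_refl : reflexive lim_equiv.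
Proof. by move=> u; apply/lim_equivP; exists 0, 0. Qed.

Lemma lim_equiv_sym : symmetric lim_equiv.
Proof.
by move=> u v; apply/lim_equivP/lim_equivP => -[p [q e]]; exists q, p.
Qed.

Lemma lim_equiv_trans : transitive lim_equiv.
Proof.
move=> v u w /lim_equivP[p [q e]] /lim_equivP[p' [q' e']]; apply/lim_equivP.
by exists (p' + p)%N, (q + q')%N; rewrite iterD e -iterD addnC iterD e' -iterD.
Qed.

Definition lim_eqr :=
  EquivRel lim_equiv lim_equiv_refl lim_equiv_sym lim_equiv_trans.

Definition direct_limit : Type := {eq_quot lim_eqr}%qT.

HB.instance Definition _ := Choice.on direct_limit.
HB.instance Definition _ := EqQuotient.on direct_limit.

Definition lim_class (u : {n & T n}) : direct_limit :=
  \pi_direct_limit%qT (u : lim_pre).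

Definition lim_rep (a : direct_limit) : {n & T n} := repr a.

Lemma lim_class_eq (u v : {n & T n}) :
  lim_class u = lim_class v <->
  exists p q, iter p lim_step u = iter q lim_step v.
Proof.
split=> [/eqP|uv]; first by rewrite eqmodE => /lim_equivP.
by apply/eqP; rewrite eqmodE; apply/lim_equivP.
Qed.

Lemma lim_repK : cancel lim_rep lim_class.
Proof. by move=> a; rewrite /lim_class /lim_rep reprK. Qed.

Fixpoint lim_shift n k : T n -> T (k + n)%N :=
  if k is k'.+1 then fun x => f _ (lim_shift k' x) else id.

Definition lim_in n (x : T n) : direct_limit := lim_class (Tagged T x).

Lemma iter_lim_step n k (x : T n) :
  iter k lim_step (Tagged T x) = Tagged T (lim_shift k x).
Proof. by elim: k => //= k ->. Qed.

Lemma lim_in_shift n k (x : T n) : lim_in (lim_shift k x) = lim_in x.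
Proof. by apply/lim_class_eq; exists 0, k; rewrite /= iter_lim_step. Qed.

Lemma lim_shiftM n k : {morph @lim_shift n k : x y / x * y}.
Proof. by elim: k => //= k IHk x y; rewrite IHk gmulfM. Qed.

Lemma lim_shiftV n k : {morph @lim_shift n k : x / x^-1}.
Proof. by elim: k => //= k IHk x; rewrite IHk gmulfV. Qed.

Lemma lim_inE n (x y : T n) :
  lim_in x = lim_in y -> exists k, lim_shift k x = lim_shift k y.
Proof.
move=> /lim_class_eq[p [q]]; rewrite !iter_lim_step => e.
have /addIn epq : (p + n = q + n)%N by exact: (congr1 tag e).
by subst q; exists p; exact: existT_inj2 e.
Qed.

Lemma lim_shift_leq n (x y : T n) k l : (k <= l)%N ->
  lim_shift k x = lim_shift k y -> lim_shift l x = lim_shift l y.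
Proof. by move=> /subnK <- e; elim: (l - k)%N => //= p ->. Qed.

Lemma lim_in_max (a b : direct_limit) :
  exists n (x y : T n), a = lim_in x /\ b = lim_in y.
Proof.
rewrite -[a]lim_repK -[b]lim_repK.
case: (lim_rep a) (lim_rep b) => m x [n y].
rewrite -/(lim_in x) -/(lim_in y) -(lim_in_shift n x) -(lim_in_shift m y).
move: (lim_shift m y); rewrite addnC => y'.
by exists (n + m)%N, (lim_shift n x), y'.
Qed.

Lemma lim_shift_common m n (x y : T m) (x' y' : T n) :
  lim_in x = lim_in x' -> lim_in y = lim_in y' ->
  lim_in (x * y) = lim_in (x' * y').
Proof.
rewrite -(lim_in_shift n x) -(lim_in_shift m x').
rewrite -(lim_in_shift n y) -(lim_in_shift m y').
rewrite -(lim_in_shift n (x * y)) -(lim_in_shift m (x' * y')) !lim_shiftM.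
move: (lim_shift m x') (lim_shift m y'); rewrite addnC => {x' y'}.
move: (lim_shift n x) (lim_shift n y) => {}x {}y x' y'.
move=> /lim_inE[k ek] /lim_inE[l el].
have ek' := lim_shift_leq (leq_addl l k) ek.
have el' := lim_shift_leq (leq_addr k l) el.
rewrite -(lim_in_shift (l + k) (x * y)) -(lim_in_shift (l + k) (x' * y')).
by rewrite !lim_shiftM ek' el'.
Qed.

(* Both factors are first moved to the term T (tag v + tag u).                *)
Definition lim_pre_mul (u v : {n & T n}) : direct_limit :=
  lim_in (lim_shift (tag v) (tagged u) *
          ecast n (T n) (addnC (tag u) (tag v)) (lim_shift (tag u) (tagged v))).

Definition lim_one : direct_limit := lim_in (1 : T 0).
Definition lim_mul (a b : direct_limit) : direct_limit :=
  lim_pre_mul (lim_rep a) (lim_rep b).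
Definition lim_inv (a : direct_limit) : direct_limit :=
  lim_in (tagged (lim_rep a))^-1.

Lemma lim_mulE n (x y : T n) : lim_mul (lim_in x) (lim_in y) = lim_in (x * y).
Proof.
rewrite /lim_mul /lim_pre_mul.
have := lim_repK (lim_in x); have := lim_repK (lim_in y).
case: (lim_rep (lim_in x)) (lim_rep (lim_in y)) => m x' [l y'] /=.
rewrite -/(lim_in x') -/(lim_in y') => ey ex.
apply: lim_shift_common; first by rewrite lim_in_shift.
rewrite -ey -(lim_in_shift m y').
by case: _ / (addnC m l).
Qed.

Lemma lim_invE n (x : T n) : lim_inv (lim_in x) = lim_in x^-1.
Proof.
rewrite /lim_inv; have := lim_repK (lim_in x).
case: (lim_rep (lim_in x)) => m x' /=; rewrite -/(lim_in x').
rewrite -(lim_in_shift n x') -(lim_in_shift m x).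
rewrite -(lim_in_shift n x'^-1) -(lim_in_shift m x^-1) !lim_shiftV.
move: (lim_shift m x) (lim_shift n x'); rewrite addnC => {x'} {}x x'.
move=> /lim_inE[k ek].
by rewrite -(lim_in_shift k x^-1) -(lim_in_shift k x'^-1) !lim_shiftV ek.
Qed.

Lemma lim_in1 n : lim_in (1 : T n) = lim_one.
Proof.
elim: n => // n <-; rewrite -(lim_in_shift 1 (1 : T n)) /=.
by rewrite gmulf1.
Qed.

Lemma lim_mulA : associative lim_mul.
Proof.
move=> a b c; have [m [x [y [-> ->]]]] := lim_in_max a b.
have [n [z [y' [-> ey]]]] := lim_in_max c (lim_in y).
rewrite -(lim_in_shift n x) -(lim_in_shift n y) -(lim_in_shift m z).
move: (lim_shift n x) (lim_shift n y) (lim_shift m z).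
rewrite [(m + n)%N]addnC => {y' ey} {}x {}y {}z.
by rewrite !lim_mulE mulgA.
Qed.

Lemma lim_mul1g : left_id lim_one lim_mul.
Proof.
move=> a; have [n [x [_ [-> _]]]] := lim_in_max a a.
by rewrite -(lim_in1 n) lim_mulE mul1g.
Qed.

Lemma lim_mulg1 : right_id lim_one lim_mul.
Proof.
move=> a; have [n [x [_ [-> _]]]] := lim_in_max a a.
by rewrite -(lim_in1 n) lim_mulE mulg1.
Qed.

Lemma lim_mulVg : left_inverse lim_one lim_inv lim_mul.
Proof.
move=> a; have [n [x [_ [-> _]]]] := lim_in_max a a.
by rewrite lim_invE lim_mulE mulVg lim_in1.
Qed.

Lemma lim_mulgV : right_inverse lim_one lim_inv lim_mul.
Proof.
move=> a; have [n [x [_ [-> _]]]] := lim_in_max a a.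
by rewrite lim_invE lim_mulE mulgV lim_in1.
Qed.

HB.instance Definition _ := isGroup.Build direct_limit
  lim_mulA lim_mul1g lim_mulg1 lim_mulVg lim_mulgV.

End DirectLimit.

Section Towers.
Local Open Scope group_scope.
Local Open Scope classical_set_scope.

Definition pair1 (G : groupType) (g : G) : (G * G)%type := (g, 1).

Lemma pair1M (G : groupType) : {morph @pair1 G : x y / x * y}.
Proof. by move=> x y; congr pair; rewrite mulg1. Qed.

HB.instance Definition _ (G : groupType) :=
  isUMagmaMorphism.Build G (G * G)%type (@pair1 G) (erefl _, @pair1M G).

(* < H x H, u | (g, g) = u (1, g) u^-1 >                                      *)
Definition binate_rel (H : groupType) (_ : unit) : set ((H * H) * (H * H)) :=
  [set ab | exists g : H, ab = ((g, g), (1, g))].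

Definition binate_step (H : groupType) : groupType := hnn (@binate_rel H).

Definition binate_emb (H : groupType) : ghom H (binate_step H) :=
  @hnn_base _ _ (@binate_rel H) \o @pair1 H.

Definition universal_binate (H : groupType) : groupType :=
  @direct_limit (fun n => iter n binate_step H) (fun n => binate_emb _).

(* One stable letter t_F for each finitely generated abelian subgroup F, and  *)
(* the relations (k, fk) = t_F (f^-1, fk) t_F^-1.                             *)
Definition A_index (G : groupType) : Type :=
  {F : set G | fg_abelian_subgroup F}.

Definition A_rel (G : groupType) (i : A_index G) : set ((G * G) * (G * G)) :=
  [set ab | exists f k : G, [/\ sval i f, centralizer (sval i) k &
              ab = ((k, f * k), (f^-1, f * k))]].

Definition A1 (G : groupType) : groupType := hnn (@A_rel G).

Definition A1_emb (G : groupType) : ghom G (A1 G) :=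
  @hnn_base _ _ (@A_rel G) \o @pair1 G.

Definition A_group (G : groupType) : groupType :=
  @direct_limit (fun n => iter n A1 G) (fun n => A1_emb _).

End Towers.

(* H_*(G; Z) is the homology of the inhomogeneous bar complex, whose n-chains *)
(* are the elements of the free abelian group on G^n.                         *)
Section BarComplex.
Variable G : groupType.
Local Open Scope ring_scope.

Definition bar_chain (n : nat) := {malg int[n.-tuple G]}.

(* Face i drops the first entry if i = 0, drops the last one if i = n + 1,    *)
(* and otherwise multiplies the entries number i - 1 and i (counted from 0).  *)
Definition bar_face (n : nat) (i : 'I_n.+2) (t : n.+1.-tuple G) : n.-tuple G :=
  [tuple if (j.+1 < i)%N then tnth t (inord j)
         else if j.+1 == i :> nat
           then (tnth t (inord j) * tnth t (inord j.+1))%g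
         else tnth t (inord j.+1) | j < n].

Definition bar_boundary (n : nat) (c : bar_chain n.+1) : bar_chain n :=
  \sum_(t <- msupp c) \sum_(i < n.+2) << (-1) ^+ i * c@_t *g bar_face i t >>.

(* The degrees m >= 1 are written n.+1: every m-cycle is an m-boundary.       *)
Definition acyclic : Prop :=
  forall (n : nat) (c : bar_chain n.+1), bar_boundary c = 0 ->
    exists b : bar_chain n.+2, bar_boundary b = c.

End BarComplex.

Section GroupRing.
Variable G : groupType.
Local Open Scope ring_scope.

Definition group_ring : Type := {malg int[G]}.

HB.instance Definition _ := GRing.Zmodule.on group_ring.

Implicit Types a b c : group_ring.

Definition gr_one : group_ring := << 1 *g (1 : G)%g >>.

Definition gr_mul a b : group_ring :=
  \sum_(x <- msupp a) \sum_(y <- msupp b) << a@_x * b@_y *g (x * y)%g >>.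

Lemma gr_mulw (d1 d2 : {fset G}) a b :
  (msupp a `<=` d1)%fset -> (msupp b `<=` d2)%fset ->
  gr_mul a b = \sum_(x <- d1) \sum_(y <- d2) << a@_x * b@_y *g (x * y)%g >>.
Proof.
move=> le1 le2; rewrite /gr_mul (big_fset_incl _ le1) /=.
  apply/eq_bigr=> x _; apply/big_fset_incl => // y _ /mcoeff_outdom ->.
  by rewrite mulr0 monalgU0.
move=> x _ /mcoeff_outdom ax.
by rewrite big1 // => y _; rewrite ax mul0r monalgU0.
Qed.

Lemma gr_mulDl : left_distributive gr_mul +%R.
Proof.
move=> a b c.
rewrite (gr_mulw (msuppD_le a b) (fsubset_refl _)).
rewrite (gr_mulw (fsubsetUl _ (msupp b)) (fsubset_refl _)).
rewrite (gr_mulw (fsubsetUr (msupp a) _) (fsubset_refl _)).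
rewrite -big_split /=; apply/eq_bigr=> x _.
rewrite -big_split /=; apply/eq_bigr=> y _.
by rewrite mcoeffD mulrDl monalgUD.
Qed.

Lemma gr_mulDr : right_distributive gr_mul +%R.
Proof.
move=> c a b.
rewrite (gr_mulw (fsubset_refl _) (msuppD_le a b)).
rewrite (gr_mulw (fsubset_refl _) (fsubsetUl _ (msupp b))).
rewrite (gr_mulw (fsubset_refl _) (fsubsetUr (msupp a) _)).
rewrite -big_split /=; apply/eq_bigr=> x _.
rewrite -big_split /=; apply/eq_bigr=> y _.
by rewrite mcoeffD mulrDr monalgUD.
Qed.

Lemma gr_mul0l : left_zero 0 gr_mul.
Proof. by move=> a; rewrite /gr_mul msupp0 big_seq_fset0. Qed.

Lemma gr_mul0r : right_zero 0 gr_mul.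
Proof.
by move=> a; rewrite /gr_mul big1 // => x _; rewrite msupp0 big_seq_fset0.
Qed.

Lemma gr_mulUU (m n : int) (x y : G) :
  gr_mul << m *g x >> << n *g y >> = << m * n *g (x * y)%g >>.
Proof. by rewrite (gr_mulw msuppU_le msuppU_le) !big_seq_fset1 !mcoeffUU. Qed.

Lemma gr_mul_suml (I : Type) (s : seq I) (F : I -> group_ring) a :
  gr_mul (\sum_(i <- s) F i) a = \sum_(i <- s) gr_mul (F i) a.
Proof.
exact: (big_morph (gr_mul^~ _) (fun _ _ => gr_mulDl _ _ _) (gr_mul0l _)).
Qed.

Lemma gr_mul_sumr (I : Type) (s : seq I) (F : I -> group_ring) a :
  gr_mul a (\sum_(i <- s) F i) = \sum_(i <- s) gr_mul a (F i).
Proof.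
exact: (big_morph (gr_mul _) (fun _ _ => gr_mulDr _ _ _) (gr_mul0r _)).
Qed.

Lemma gr_ind (P : group_ring -> Prop) :
  P 0 -> (forall a b, P a -> P b -> P (a + b)) ->
  (forall (m : int) (x : G), P << m *g x >>) -> forall a, P a.
Proof.
by move=> P0 PD PU a; rewrite [a]monalgE; elim/big_ind: _ => // x _; exact: PU.
Qed.

Lemma gr_mul1l : left_id gr_one gr_mul.
Proof.
elim/gr_ind => [|a b ea eb|m x]; first by rewrite gr_mul0r.
  by rewrite gr_mulDr ea eb.
by rewrite gr_mulUU mul1r mul1g.
Qed.

Lemma gr_mul1r : right_id gr_one gr_mul.
Proof.
elim/gr_ind => [|a b ea eb|m x]; first by rewrite gr_mul0l.
  by rewrite gr_mulDl ea eb.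
by rewrite gr_mulUU mulr1 mulg1.
Qed.

Lemma gr_mulA : associative gr_mul.
Proof.
move=> a b c; elim/gr_ind: a => [|a a' ea ea'|m x].
- by rewrite !gr_mul0l.
- by rewrite !gr_mulDl ea ea'.
elim/gr_ind: b => [|b b' eb eb'|n y].
- by rewrite gr_mul0l gr_mul0r gr_mul0l.
- by rewrite gr_mulDl !gr_mulDr gr_mulDl eb eb'.
elim/gr_ind: c => [|c c' ec ec'|p z].
- by rewrite !gr_mul0r.
- by rewrite !gr_mulDr ec ec'.
by rewrite !gr_mulUU mulrA mulgA.
Qed.

Lemma gr_one_neq0 : gr_one != 0.
Proof. by rewrite monalgU_eq0. Qed.

HB.instance Definition _ := GRing.Zmodule_isNzRing.Build group_ring
  gr_mulA gr_mul1l gr_mul1r gr_mulDl gr_mulDr gr_one_neq0.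

End GroupRing.

Section Projective.
Variable R : nzRingType.
Local Open Scope ring_scope.

Definition fg_module (P : lmodType R) : Prop :=
  exists (n : nat) (f : {linear 'rV[R]_n -> P}), forall y, exists x, f x = y.

Definition projective (P : lmodType R) : Prop :=
  forall (M N : lmodType R) (q : {linear M -> N}) (h : {linear P -> N}),
    (forall y, exists x, q x = y) ->
    exists l : {linear P -> M}, forall x, q (l x) = h x.

(* P is isomorphic to the submodule R^n E of the row vectors fixed by the     *)
(* idempotent E : i is the resulting inclusion and p the projection onto P.   *)
Definition represents (n : nat) (E : 'M[R]_n) (P : lmodType R) : Prop :=
  E *m E = E /\
  exists (i : {linear P -> 'rV[R]_n}) (p : {linear 'rV[R]_n -> P}),
    (forall x, p (i x) = x) /\ (forall v, i (p v) = v *m E).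

End Projective.

Section WeakBass.
Variable G : groupType.
Local Open Scope ring_scope.
Local Open Scope classical_set_scope.

(* This is r_P(s) when M is the trace of an idempotent matrix representing P. *)
(* Sums over \in range over the finitely many indices with nonzero term.      *)
Definition class_coeff (M : group_ring G) (s : set G) : int :=
  \sum_(g \in s) M@_g.

Definition nontrivial_classes : set (set G) :=
  [set conj_class g | g in [set: G]] `\ conj_class (1%g : G).

Definition weak_bass : Prop :=
  forall P : lmodType (group_ring G), fg_module P -> projective P ->
  forall (n : nat) (E : 'M[group_ring G]_n), represents E P ->
    \sum_(s \in nontrivial_classes) class_coeff (\tr E) s = 0.

End WeakBass.

(* Main.v *)
Require Import Defs.
From HB Require Import structures.
From mathcomp Require Import all_boot all_algebra.
From mathcomp Require Import finmap monalg boolp classical_sets fsbigop.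

(** By the identity sum_(s <> [e]) r_P(s) = aug (tr E) - (tr E)_e, where aug is
    the sum of the coefficients, the weak Bass conjecture for G is a statement
    about idempotent matrices E over ZG only: aug (tr E) = (tr E)_e
    (weak_bassP).  One direction needs the projective module that E represents,
    which is realized as the module of the row vectors fixed by E.

    In this form the conjecture descends along maps phi : G -> H that are only
    locally multiplicative: if phi is multiplicative and sends no nontrivial
    element to 1 on the finitely many elements that occur in E and tr E, then
    applying phi to the coefficients of E gives an idempotent matrix over ZH,
    whose trace has the same augmentation and the same coefficient at 1
    (weak_bass_local).  Such maps exist for all finite sets of elements in two
    cases:
    - G is a subgroup of H, so the conjecture passes to subgroups;
    - G is arbitrary and H contains every finitely presented group.  A finite
      subset s of G generates, subject to the finitely many relations
      ab = cd that hold in G among elements of s and 1, a finitely presented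
      group K; the partial multiplication table of s lifts to K, and nontrivial
      elements of s stay nontrivial because K maps back to G
      (fp_universal_locally).
    Hence the conjecture for BM implies it for all groups.

    What is left is that BM embeds in its universal binate group and in A(BM).
    A direct limit of injections contains its first term, so it suffices that
    the base of each of the two HNN extensions embeds.  Instead of a normal form
    theorem, an action on the set of elements of the base group is used: the
    base acts by left translation, and each stable letter by a permutation that
    intertwines the translations by the associated subgroups (hnn_base_inj).
    Here the permutations are explicit: (x, y) |-> (y x, y) for the binate
    extension, and for the letter of F a formula in terms of coset
    decompositions for F and its centralizer (A1_emb_inj). *)

Set Implicit Arguments.
Unset Strict Implicit.
Unset Printing Implicit Defensive.

Import GRing.Theory.
Local Open Scope ring_scope.

(** * Words acting on a set *)

Section WordAction.
Variables (X Y : Type) (R : set (word X)) (A : X * bool -> Y -> Y).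

Definition word_act (w : word X) (p : Y) : Y := foldr A p w.

Lemma word_act_cat u v p : word_act (u ++ v) p = word_act u (word_act v p).
Proof. by rewrite /word_act foldr_cat. Qed.

(** This serves as the universal property of a presentation, with values in the
    permutations of Y: it shows that words represent different elements by
    letting them move a point differently. *)
Lemma word_act_cong :
  (forall x b p, A (x, b) (A (x, ~~ b) p) = p) ->
  (forall r p, R r -> word_act r p = p) ->
  forall u v, word_cong R u v -> word_act u =1 word_act v.
Proof.
move=> AK AR u v.
elim=> {u v} [//|u v _ IH p|u v w _ IH1 _ IH2 p|u u' v v' _ IH1 _ IH2 p
  |x b p|r].
- by rewrite IH.
- by rewrite IH1 IH2.
- by rewrite !word_act_cat IH2 IH1.
- exact: AK.
- by move=> Rr p; apply: AR.
Qed.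

End WordAction.

(** * Embeddings into HNN extensions and direct limits *)

Section HNNInjective.
Variables (G : groupType) (I : Type) (S : I -> set (G * G)).
Local Open Scope group_scope.

(** The base acts on itself by left translation and the letter t_i by the
    permutation t; the hypothesis on t is exactly the relation a t_i = t_i b.
    The base is faithful in this action, as g and h differ at the point 1. *)
Lemma hnn_base_inj :
  (forall i, exists t : G -> G, bijective t /\
     forall a b p, S i (a, b) -> t (b * p) = a * t p) ->
  injective (hnn_base S).
Proof.
move=> /choice[t ht].
have /choice[s hs] i : exists s : G -> G, cancel (t i) s /\ cancel s (t i).
  by have [[s ts st] _] := ht i; exists s.
pose A (l : (G + I) * bool) (p : G) : G :=
  match l with
  | (inl g, false) => g * p
  | (inl g, true) => g^-1 * p
  | (inr i, false) => t i p
  | (inr i, true) => s i p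
  end.
move=> g h /word_class_eq gh.
suff /(_ 1) : word_act A [:: (inl g, false)] =1 word_act A [:: (inl h, false)].
  by rewrite /= !mulg1.
apply: word_act_cong gh => [[x|i] [] p /=|_ p [x y|i a b Sab] /=].
- by rewrite mulKg.
- by rewrite mulVKg.
- exact: (hs i).1.
- exact: (hs i).2.
- by rewrite mulgA mulVKg.
- by rewrite -(proj2 (ht i) a b) // mulVKg (hs i).2.
Qed.

End HNNInjective.

Section Embeddings.
Variable G : groupType.
Local Open Scope group_scope.
Local Open Scope classical_set_scope.

Lemma pair1_inj : injective (@pair1 G).
Proof. by move=> x y []. Qed.

(** The permutation is (x, y) |-> (y x, y): it turns translation by (1, g) into
    translation by (g, g). *)
Lemma binate_emb_inj : injective (binate_emb G).
Proof.
apply: inj_comp pair1_inj; apply: hnn_base_inj => -[].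
exists (fun p => (p.2 * p.1, p.2)); split.
  exists (fun p : G * G => (p.2^-1 * p.1, p.2)) => -[x y] /=.
    by rewrite mulKg.
  by rewrite mulVKg.
by move=> a b [x y] [g [-> ->]]; congr pair; rewrite /= mul1g mulgA.
Qed.

(** With r x the chosen representative of the right coset F x, the map c is the
    component c x = x (r x)^-1 of x in F. *)
Lemma subgroup_retraction (F : set G) : is_subgroup F ->
  exists c : G -> G,
    (forall x, F (c x)) /\ (forall f x, F f -> c (f * x) = f * c x).
Proof.
move=> [F1 FV].
have FI x : F x -> F x^-1 by move=> Fx; rewrite -[x^-1]mul1g; apply: FV.
have FM x y : F x -> F y -> F (x * y).
  by move=> Fx Fy; rewrite -[y]invgK; apply: FV => //; apply: FI.
pose cs x : set G := [set r | F (x * r^-1)].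
have csE f x : F f -> cs (f * x) = cs x.
  move=> Ff; apply/seteqP; split=> r; rewrite /cs /= -mulgA => h.
    by rewrite -[_ * _](mulKg f); apply: FM => //; apply: FI.
  exact: FM.
(* The representative is chosen as a function of the set cs x, so that *)
(* elements of the same coset get the same one. *)
exists (fun x => x * (xget 1 (cs x))^-1); split=> [x|f x Ff].
  by apply: (@xgetI _ 1 (cs x) x); rewrite /cs /= mulgV.
by rewrite csE // mulgA.
Qed.

Lemma centralizer_subgroup (F : set G) : is_subgroup (centralizer F).
Proof.
split=> [f _|x y Cx Cy f Ff]; first exact/commute_sym/commute1.
by apply/commute_sym/commuteM; [|apply: commuteV]; apply/commute_sym; auto.
Qed.

Lemma generated_subgroup (A : set G) : is_subgroup (generated A).
Proof.
split=> [B [[B1 _] _]|x y Ax Ay B [BS AB]] //.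
by apply: BS.2; [apply: Ax|apply: Ay].
Qed.

(** Let f and c be the components in F and in its centralizer C.  Cosets of
    {(f^-1, fk)} are described by the pair of cosets F x and C y, and
    (x, y) |-> (x, (c x)^-1 y) describes cosets of {(k, fk)} by a C-coset and an
    F-coset, as F is central in C.  Matching the two gives the
    permutation (x, y) |-> (f x y, c y (f x)^-1 x). *)
Lemma A1_emb_inj : injective (A1_emb G).
Proof.
apply: inj_comp pair1_inj; apply: hnn_base_inj => -[F [[s Fs] Fab]].
have /subgroup_retraction[f [Ff fM]] : is_subgroup F.
  by rewrite Fs; apply: generated_subgroup.
have [c [Cc cM]] := subgroup_retraction (centralizer_subgroup F).
have FC x : F x -> centralizer F x by move=> Fx y Fy; apply: Fab.
have FV x : F x -> F x^-1.
  rewrite Fs; have [F1 FM] := generated_subgroup [set` s].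
  by move=> Fx; rewrite -[x^-1]mul1g; apply: FM.
pose t (p : G * G) := (f p.1 * p.2, c p.2 * ((f p.1)^-1 * p.1)).
exists t; split.
  (* If (p, q) = t (x, y), then w = (c p)^-1 q is (f x)^-2 x, so that *)
  (* f w = (f x)^-1 and both x and y can be recovered. *)
  pose w (q : G * G) := (c q.1)^-1 * q.2.
  exists (fun q : G * G => ((f (w q))^-1 * (f (w q))^-1 * w q, f (w q) * q.1)).
    move=> [x y]; rewrite /t /w /=.
    have Fx := Ff x; have FVx := FV _ Fx.
    have -> : (c (f x * y))^-1 * (c y * ((f x)^-1 * x)) =
              (f x)^-1 * ((f x)^-1 * x).
      rewrite cM; last exact: FC.
      by rewrite -(Cc y _ Fx) invgM -!mulgA mulKg.
    by rewrite !fM // mulVg mulg1 invgK -mulgA !mulVKg mulKg.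
  move=> [p q]; rewrite /t /w /=; set w0 := _ * q.
  have cw : c p * w0 = q by rewrite mulVKg.
  move: w0 cw => w0 cw.
  have Fw := Ff w0; have FVw := FV _ Fw.
  have -> : f ((f w0)^-1 * (f w0)^-1 * w0) = (f w0)^-1.
    by rewrite -mulgA !fM // mulVg mulg1.
  rewrite cM; last exact: FC.
  by rewrite invgK mulKg -(Cc p _ Fw) -!mulgA !mulVKg cw.
move=> a b [x y] [g [k [/= Fg Ck [-> ->]]]].
have Cgk : centralizer F (g * k).
  by move=> h Fh; apply/commute_sym/commuteM; apply/commute_sym;
    [apply: FC|apply: Ck].
rewrite /t /= fM; last exact: FV.
rewrite cM //; congr pair; last by rewrite invgM invgK -!mulgA mulVKg.
by rewrite /= -mulgA [f x * (_ * y)]mulgA -(Cgk _ (Ff x)) -!mulgA mulKg.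
Qed.

End Embeddings.

Lemma lim_embeds (T : nat -> groupType) (f : forall n, ghom (T n) (T n.+1)) :
  (forall n, injective (f n)) -> embeds (T 0) (direct_limit f).
Proof.
move=> f_inj.
have in_inj : injective (@lim_in T f 0).
  move=> x y /lim_inE[k]; elim: k => [//|k IHk] /f_inj; exact: IHk.
have inM : {morph @lim_in T f 0 : x y / (x * y)%g}.
  by move=> x y; rewrite -lim_mulE.
pose h := isUMagmaMorphism.Build (T 0) (direct_limit f) _ (lim_in1 f 0, inM).
by exists (HB.pack_for (ghom (T 0) (direct_limit f)) (@lim_in T f 0) h).
Qed.

(** * Idempotent matrices and the module they represent *)

Section LinearExtension.
Variables (K : choiceType) (V : zmodType) (f : K -> V).

Definition malg_lift (a : {malg int[K]}) : V := \sum_(x <- msupp a) f x *~ a@_x.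

Lemma malg_liftw (d : {fset K}) a : (msupp a `<=` d)%fset ->
  malg_lift a = \sum_(x <- d) f x *~ a@_x.
Proof.
move=> le; apply: big_fset_incl => // x _ /mcoeff_outdom ->.
by rewrite mulr0z.
Qed.

Lemma malg_lift_additive : additive malg_lift.
Proof.
move=> a b.
rewrite (malg_liftw (msuppB_le a b)).
rewrite (malg_liftw (fsubsetUl (msupp a) (msupp b))).
rewrite (malg_liftw (fsubsetUr (msupp a) (msupp b))).
rewrite -sumrB; apply: eq_bigr => x _.
by rewrite mcoeffB mulrzBr.
Qed.

HB.instance Definition _ :=
  GRing.isAdditive.Build {malg int[K]} V malg_lift malg_lift_additive.

Lemma malg_liftU m x : malg_lift << m *g x >> = f x *~ m.
Proof. by rewrite (malg_liftw msuppU_le) big_seq_fset1 mcoeffUU. Qed.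

End LinearExtension.

Section IdempotentImage.
Variables (R : nzRingType) (n : nat) (E : 'M[R]_n).

Definition fixed_row : {pred 'rV[R]_n} := [pred v | v *m E == v].

Lemma fixed_row_submod : submod_closed fixed_row.
Proof.
split=> [|a u v]; rewrite !inE ?mul0mx //.
by move=> /eqP eu /eqP ev; rewrite mulmxDl -scalemxAl eu ev.
Qed.

HB.instance Definition _ := GRing.isSubmodClosed.Build R 'rV[R]_n fixed_row
  fixed_row_submod.

Record row_image := RowImage { row_val : 'rV[R]_n; _ : row_val \in fixed_row }.
HB.instance Definition _ := [isSub for row_val].
HB.instance Definition _ := [Choice of row_image by <:].
HB.instance Definition _ := [SubChoice_isSubLmodule of row_image by <:].

Hypothesis E_idem : E *m E = E.

Fact row_proj_subproof (v : 'rV[R]_n) : v *m E \in fixed_row.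
Proof. by rewrite inE -mulmxA E_idem. Qed.

Definition row_proj v := RowImage (row_proj_subproof v).

Lemma row_proj_linear : linear row_proj.
Proof. by move=> a u v; apply: val_inj; rewrite /= mulmxDl -scalemxAl. Qed.

End IdempotentImage.

(** * The conjecture in terms of the augmentation *)

Section Augmentation.
Variable G : groupType.
Local Open Scope classical_set_scope.
Implicit Types a b : group_ring G.

Definition augmentation a : int := malg_lift (fun=> 1) a.

Lemma augmentationE a : augmentation a = \sum_(g <- msupp a) a@_g.
Proof. by apply: eq_bigr => g _; rewrite intz. Qed.

Lemma conj_class_id (g : G) : conj_class g g.
Proof. by exists 1%g; rewrite mul1g invg1 mulg1. Qed.

Lemma conj_class1 : conj_class (1%g : G) = [set 1%g].
Proof.
apply/seteqP; split=> [_ [h ->]|_ ->]; last exact: conj_class_id.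
by rewrite /= mulg1 mulgV.
Qed.

Lemma conj_class_eq (g x : G) : conj_class g x -> conj_class x = conj_class g.
Proof.
move=> [h ->]; apply/seteqP; split=> _ [k ->].
  by exists (k * h)%g; rewrite invgM !mulgA.
by exists (k * h^-1)%g; rewrite invgM invgK !mulgA !mulgVK.
Qed.

Lemma class_coeffE a (s : set G) :
  class_coeff a s = \sum_(g <- msupp a | g \in s) a@_g.
Proof.
rewrite /class_coeff [RHS]bigfs ?fset_uniq //.
  by apply: eq_fsbigl; apply/seteqP; split=> x; rewrite /= inE.
by move=> x _ /mcoeff_outdom.
Qed.

(** The classes partition G and the class of 1 is {1}; only the finitely many
    classes r that meet the support of a contribute. *)
Lemma sum_nontrivial_classes a :
  \sum_(s \in @nontrivial_classes G) class_coeff a s = augmentation a - a@_1%g.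
Proof.
pose r := undup [seq s <- [seq conj_class g | g <- msupp a]
                | s != conj_class (1%g : G)].
have in_r (g : G) : g \in msupp a -> (conj_class g \in r) = (g != 1%g).
  move=> ag; rewrite mem_undup mem_filter map_f // andbT; congr (~~ _).
  apply/eqP/eqP => [e|-> //].
  by have := conj_class_id g; rewrite e conj_class1.
rewrite (@fsbigE _ _ _ _ _ r) ?undup_uniq //; last 2 first.
- move=> s /=; rewrite mem_undup mem_filter => /andP[/eqP s1 /mapP[g _ sg]].
  by split=> //; exists g.
- move=> s [[g _ <-] /= s1] rg; rewrite class_coeffE big_seq_cond big1 // => x.
  move=> /andP[ax]; rewrite inE => gx.
  case/negP: rg; rewrite -(conj_class_eq gx) in_r //.
  by apply: contra_notN s1 => /eqP x1; rewrite -(conj_class_eq gx) x1.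
have r_class s : s \in r -> exists g, conj_class g = s.
  by rewrite mem_undup mem_filter => /andP[_ /mapP[g _ ->]]; exists g.
transitivity (\sum_(s <- r) class_coeff a s).
  rewrite big_mkcond; apply: eq_big_seq => s sr; rewrite ifT // inE.
  have [g gs] := r_class s sr; split; first by exists g.
  by move: sr; rewrite mem_undup mem_filter => /andP[/eqP].
have inner g : g \in msupp a ->
    \sum_(s <- r | g \in s) a@_g = if g != 1%g then a@_g else 0.
  move=> ag; rewrite -in_r // -big_filter.
  have -> : [seq s <- r | g \in s] = [seq s <- r | s == conj_class g].
    apply: eq_in_filter => s /r_class[h <-].
    apply/idP/eqP => [/set_mem/conj_class_eq //|->].
    exact/mem_set/conj_class_id.
  case: ifPn => [rg|rg].
    by rewrite filter_pred1_uniq ?undup_uniq // big_seq1.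
  rewrite big_filter big_seq_cond big1 // => s /andP[sr /eqP es].
  by rewrite -es sr in rg.
under eq_bigr do rewrite class_coeffE.
rewrite (exchange_big_dep predT) //= augmentationE (eq_big_seq _ inner).
rewrite -big_mkcond [in RHS](bigID (pred1 1%g)) /= addrAC -[LHS]add0r.
congr (_ + _); apply/esym/eqP; rewrite subr_eq0 -big_filter.
have [a1|a1] := boolP ((1 : G)%g \in msupp a).
  by rewrite filter_pred1_uniq ?fset_uniq // big_seq1.
rewrite (mcoeff_outdom a1) big_filter big_seq_cond big1 // => g.
by move=> /andP[ag /eqP g1]; rewrite -g1 ag in a1.
Qed.

(** The module row_image E is the retract v |-> v E of a free module, hence
    finitely generated and projective, and E represents it. *)
Lemma weak_bassP :
  weak_bass G <->
  forall n (E : 'M[group_ring G]_n), E *m E = E ->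
    augmentation (\tr E) = (\tr E)@_1%g.
Proof.
split=> [wb n E EE|wb P _ _ n E [EE _]]; last first.
  by rewrite sum_nontrivial_classes wb // subrr.
apply/eqP; rewrite -subr_eq0 -sum_nontrivial_classes; apply/eqP.
pose P : lmodType (group_ring G) := row_image E.
pose pr := GRing.isLinear.Build _ 'rV_n P _ (row_proj EE) (row_proj_linear EE).
pose p : {linear 'rV_n -> P} := HB.pack (row_proj EE) pr.
pose i : {linear P -> 'rV_n} := val.
have pi x : p (i x) = x.
  by apply: val_inj; apply/eqP; have := valP x; rewrite inE.
apply: (wb P); last by split=> //; exists i, p.
- by exists n, p => y; exists (i y).
- move=> M N q h q_surj.
  have /choice[s qs] (j : 'I_n) := q_surj (h (p (delta_mx 0 j))).
  pose l0 (v : 'rV[group_ring G]_n) : M := \sum_j v 0 j *: s j.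
  have l0_lin : linear l0.
    move=> a u v; rewrite /l0 scaler_sumr -big_split /=; apply: eq_bigr => j _.
    by rewrite !mxE scalerDl scalerA.
  pose lr := GRing.isLinear.Build _ 'rV_n M _ l0 l0_lin.
  pose l : {linear 'rV_n -> M} := HB.pack l0 lr.
  exists (l \o i) => x.
  rewrite -{2}[x]pi [i x in RHS]row_sum_delta !linear_sum.
  apply: eq_bigr => j _; by rewrite !linearZ qs.
Qed.

End Augmentation.

(** * Descent along local embeddings *)

Section LocalEmbedding.

(** This is local embeddability of G into H: on enlarging s by inverses and
    products, triviality of the kernel on s gives injectivity on s. *)
Definition locally_embeds (G H : groupType) : Prop :=
  forall s : seq G, exists phi : G -> H,
    [/\ phi 1%g = 1%g, {in s &, {morph phi : x y / (x * y)%g}}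
      & {in s, forall x, phi x = 1%g -> x = 1%g}].

Lemma embeds_locally (G H : groupType) : embeds G H -> locally_embeds G H.
Proof.
move=> [f f_inj] s; exists f; split=> [|x y _ _|x _ fx]; first exact: gmulf1.
  exact: gmulfM.
by apply: f_inj; rewrite fx gmulf1.
Qed.

Variables (G H : groupType) (phi : G -> H).
Implicit Types a b : group_ring G.

Definition gr_push a : group_ring H := malg_lift (fun g => << 1 *g phi g >>) a.

Lemma gr_pushU m g : gr_push << m *g g >> = << m *g phi g >>.
Proof. by rewrite /gr_push malg_liftU -raddfMz /= intz. Qed.

Lemma gr_push_additive : additive gr_push.
Proof. exact: malg_lift_additive. Qed.

HB.instance Definition _ :=
  GRing.isAdditive.Build (group_ring G) (group_ring H) gr_push gr_push_additive.

Lemma gr_pushE a : gr_push a = \sum_(g <- msupp a) << a@_g *g phi g >>.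
Proof.
rewrite {1}[a]monalgE (raddf_sum gr_push) /=.
by apply: eq_bigr => g _; rewrite gr_pushU.
Qed.

Lemma gr_pushM a b :
  {in msupp a & msupp b, forall x y, phi (x * y)%g = (phi x * phi y)%g} ->
  gr_push (a * b) = gr_push a * gr_push b.
Proof.
move=> phiM; rewrite (gr_pushE a) (gr_pushE b) mulr_suml.
rewrite [a * b]/(gr_mul a b) /gr_mul (raddf_sum gr_push) /=.
apply: eq_big_seq => x ax; rewrite mulr_sumr (raddf_sum gr_push) /=.
by apply: eq_big_seq => y yb; rewrite gr_pushU phiM //; apply/esym/gr_mulUU.
Qed.

Lemma augmentation_push a : augmentation (gr_push a) = augmentation a.
Proof.
rewrite /augmentation gr_pushE raddf_sum /=; apply: eq_bigr => g _.
by rewrite malg_liftU.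
Qed.

Lemma gr_push_coeff1 a : phi 1%g = 1%g ->
  {in msupp a, forall x, phi x = 1%g -> x = 1%g} ->
  (gr_push a)@_1%g = a@_1%g.
Proof.
move=> phi1 inj1; rewrite gr_pushE [in RHS](monalgE a) !raddf_sum /=.
apply: eq_big_seq => g ag; rewrite !mcoeffU; congr (_ *+ nat_of_bool _).
by apply/eqP/eqP => [/inj1 -> //|->].
Qed.

End LocalEmbedding.

(** The equation E * E = E only involves products of elements of the finitely
    many supports, so a map phi which is multiplicative there preserves it. *)
Lemma weak_bass_local (G H : groupType) :
  locally_embeds G H -> weak_bass H -> weak_bass G.
Proof.
move=> GH /weak_bassP wb; apply/weak_bassP => n E EE.
pose supports := flatten [seq (msupp (E p.1 p.2) : seq G)
                         | p <- enum {: 'I_n * 'I_n}].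
have [phi [phi1 phiM phi_inj]] := GH (msupp (\tr E) ++ supports).
have in_supp i j x : x \in msupp (E i j) -> x \in msupp (\tr E) ++ supports.
  move=> xE; rewrite mem_cat; apply/orP; right; apply/flatten_mapP.
  by exists (i, j); rewrite ?mem_enum.
have tr_push : \tr (map_mx (gr_push phi) E) = gr_push phi (\tr E).
  by rewrite /mxtrace raddf_sum; apply: eq_bigr => i _; rewrite mxE.
rewrite -(augmentation_push phi) -(@gr_push_coeff1 _ _ phi) //; last first.
  by move=> x xE; apply: phi_inj; rewrite mem_cat xE.
rewrite -tr_push; apply: wb; apply/matrixP => i j.
transitivity (gr_push phi ((E *m E) i j)); last by rewrite EE mxE.
rewrite !mxE raddf_sum; apply: eq_bigr => k _.
by rewrite !mxE /= gr_pushM // => x y xE yE; apply: phiM; apply: in_supp; eauto.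
Qed.

(** A relator for each solution of e i * e j = e k * e l makes the lift of a
    product e i * e j independent of its factors.  Since e takes the value 1 at
    ord0, whose generator is killed, it also makes the lift of an element of s
    agree with its lift as a product. *)
Lemma fp_universal_locally (G H : groupType) :
  (forall K : groupType, finitely_presented K -> embeds K H) ->
  locally_embeds G H.
Proof.
move=> univ s; pose n := (size s).+1.
pose e (i : 'I_n) : G := nth 1%g (1%g :: s) i.
pose products := [seq q <- enum {: 'I_n * 'I_n * ('I_n * 'I_n)}
                 | (e q.1.1 * e q.1.2 == e q.2.1 * e q.2.2)%g].
pose rel (q : 'I_n * 'I_n * ('I_n * 'I_n)) : word 'I_n :=
  [:: (q.1.1, false); (q.1.2, false); (q.2.2, true); (q.2.1, true)].
pose rels : seq (word 'I_n) :=
  [:: (ord0, false)] :: [seq rel q | q <- products].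
pose K : groupType := presented [set` rels]%classic.
pose cls (w : word 'I_n) : K := word_class [set` rels]%classic w.
have [h h_inj] : embeds K H.
  apply: univ; exists n, rels; exists (idfun : ghom K K).
  by exists idfun.
pose gen (i : 'I_n) : K := cls [:: (i, false)].
have genP i j k l :
  (e i * e j = e k * e l)%g -> (gen i * gen j = gen k * gen l)%g.
  move=> eq_e.
  have genV x : ((gen x)^-1)%g = cls [:: (x, true)].
    exact: presented_invE.
  have mulE u v : (cls u * cls v)%g = cls (u ++ v).
    exact: presented_mulE.
  have : (gen i * gen j * ((gen l)^-1 * (gen k)^-1))%g = 1%g.
    rewrite !genV (mulE [:: _] [:: _]) (mulE [:: (l, true)]) mulE.
    apply/word_class_eq/WCrel.
    rewrite /= inE; apply/orP; right; apply/mapP; exists (i, j, (k, l)) => //.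
    by rewrite mem_filter mem_enum andbT; apply/eqP.
  by move=> rel1; rewrite -[RHS]mul1g -rel1 -!mulgA mulKg mulVg mulg1.
have gen0 : gen ord0 = 1%g.
  by apply/word_class_eq/WCrel; rewrite /= inE eqxx.
have gen1 i : gen i = 1%g -> e i = 1%g.
  (* K acts on G through the homomorphism to G that sends gen i to e i. *)
  pose A (l : 'I_n * bool) (x : G) : G :=
    (if l.2 then (e l.1)^-1 * x else e l.1 * x)%g.
  move=> /word_class_eq cong1.
  suff /(_ 1%g) : word_act A [:: (i, false)] =1 word_act A [::].
    by rewrite /word_act /A /= mulg1.
  apply: word_act_cong cong1 => [x [] p|r p]; rewrite /A /=.
  - by rewrite mulKg.
  - by rewrite mulVKg.
  rewrite inE => /predU1P[-> /=|/mapP[q]]; first by rewrite mul1g.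
  rewrite mem_filter => /andP[/eqP eq_q _] -> /=.
  by rewrite mulgA eq_q -mulgA !mulVKg.
pose phi (g : G) : K :=
  if [pick p : 'I_n * 'I_n | e p.1 * e p.2 == g]%g is Some p
  then (gen p.1 * gen p.2)%g else 1%g.
have phiM i j : phi (e i * e j)%g = (gen i * gen j)%g.
  rewrite /phi; case: pickP => [p /eqP /genP //|/(_ (i, j))].
  by rewrite eqxx.
have phi_gen i : phi (e i) = gen i.
  by rewrite -[e i]mulg1 (phiM i ord0) gen0 mulg1.
have in_e x : x \in s -> exists i, x = e i.
  move=> xs; have xs1 : x \in 1%g :: s by rewrite inE xs orbT.
  have lt_i : (index x (1%g :: s) < n)%N by rewrite index_mem.
  by exists (Ordinal lt_i); rewrite /e nth_index.
exists (h \o phi); split=> [|x y /in_e[i ->] /in_e[j ->]|x /in_e[i ->]] /=.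
- by rewrite (phi_gen ord0) gen0 gmulf1.
- by rewrite phiM !phi_gen gmulfM.
- by rewrite phi_gen -[X in _ = X -> _](gmulf1 (s := h)) => /h_inj /gen1.
Qed.

Theorem corollary4p5 (BM : groupType)
  (BM_fp : finitely_presented BM)
  (BM_stg : strongly_torsion_generated BM)
  (BM_acyclic : acyclic BM)
  (BM_univ : forall K : groupType, finitely_presented K -> embeds K BM) :
  [<-> forall G : groupType, weak_bass G;
       weak_bass BM;
       weak_bass (universal_binate BM);
       weak_bass (A_group BM)].
Proof.
have wb_all : weak_bass BM -> forall G : groupType, weak_bass G.
  by move=> wb G; apply: weak_bass_local wb; apply: fp_universal_locally.
have BM_binate : embeds BM (universal_binate BM).
  exact: (@lim_embeds (fun n => iter n binate_step BM)
                      (fun n => binate_emb _) (fun n => @binate_emb_inj _)).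
have BM_A : embeds BM (A_group BM).
  exact: (@lim_embeds (fun n => iter n A1 BM)
                      (fun n => A1_emb _) (fun n => @A1_emb_inj _)).
have restrict G : embeds BM G -> weak_bass G -> weak_bass BM.
  by move=> /embeds_locally/weak_bass_local.
tfae.
- by move=> wb; apply: wb.
- by move=> /wb_all; apply.
- by move=> /(restrict _ BM_binate)/wb_all; apply.
- by move=> /(restrict _ BM_A)/wb_all.
Qed.
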